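(* Let $\mu$ be a probability measure on $\mathbb{R}$ such that $m_1(\mu)=0$, $m_2(\mu)=1$ and $m_4(\mu)<+\infty$. For $n\ge1$ let $\mu_n$ be the dilation of $\mu^{\uplus n}$ by $\frac1{\sqrt n}$, i.e. $\mu_n(A)=\mu^{\uplus n}\left(\{x:\frac1{\sqrt n}x\in A\}\right)$ for Borel sets $A$. Then for all $n\ge1$, $$W_1(\mu_n,\mathrm{b})\le\frac1{\sqrt n}\sqrt{m_4(\mu)-1}.$$
   Context: $\mathrm{b}=\frac12\delta_{-1}+\frac12\delta_{1}$ is the Rademacher distribution; $m_k(\mu)=\int x^k\,d\mu(x)$; $W_1(\mu,\nu)=\inf_\pi\iint|x-y|\,d\pi(x,y)$, the infimum being over all couplings of $(\mu,\nu)$. For a probability measure $\mu$ on $\mathbb{R}$ and $z$ in the upper half-plane, let $G_\mu(z)=\int\frac{1}{z-x}\,d\mu(x)$ and $K_\mu(z)=z-1/G_\mu(z)$. The Boolean convolution $\mu\uplus\nu$ of two probability measures on $\mathbb{R}$ is the unique probability measure with $K_{\mu\uplus\nu}(z)=K_\mu(z)+K_\nu(z)$ for all $z$ with $\Im z>0$; $\mu^{\uplus n}$ is the $n$-fold Boolean convolution of $\mu$ with itself. *)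

(* Defs.v *)
From HB Require Import structures.
From mathcomp Require Import all_boot all_order all_algebra.
From mathcomp Require Import complex.
From mathcomp Require Import all_classical all_reals all_analysis.
From mathcomp Require Import measurable_realfun.

Set Implicit Arguments.
Unset Strict Implicit.
Unset Printing Implicit Defensive.

Import Order.TTheory GRing.Theory Num.Theory.
Import numFieldNormedType.Exports.

Local Open Scope classical_set_scope.
Local Open Scope ring_scope.
Local Open Scope complex_scope.

(* The canonical sigma-algebra of [R : realType], generated by the intervals
   ]a, b], is the Borel one: [probability R R] is the type of Borel probability
   measures on the real line. *)

Definition moment (R : realType) (k : nat) (mu : probability R R) : \bar R :=
  (\int[mu]_x (x ^+ k)%:E)%E.

(* The complex-valued integral is taken componentwise.  It is only used for
   [0 < Im z], where both components of the integrand are bounded in [x]. *)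
Definition cauchy_transform (R : realType) (mu : probability R R) (z : R[i]) :
    R[i] :=
  Rintegral mu setT (fun x : R => complex.Re (1 / (z - x%:C)))
  +i* Rintegral mu setT (fun x : R => complex.Im (1 / (z - x%:C))).

Definition K_transform (R : realType) (mu : probability R R) (z : R[i]) :
    R[i] :=
  z - 1 / cauchy_transform mu z.

(* The Boolean convolution of [mu] and [nu] is the unique [rho] satisfying this
   equation; it is rendered as a relation so that no choice is involved. *)
Definition is_boolean_conv (R : realType) (mu nu rho : probability R R) :
    Prop :=
  forall z : R[i], 0 < complex.Im z ->
    K_transform rho z = K_transform mu z + K_transform nu z.

(* Library measures are functions on all sets, of which only the values on
   measurable sets are meaningful; hence the first constructor does not ask for
   [rho = mu]. *)
Inductive is_boolean_power (R : realType) (mu : probability R R) :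
    nat -> probability R R -> Prop :=
| boolean_power1 (rho : probability R R) :
    (forall A : set R, measurable A -> rho A = mu A) ->
    is_boolean_power mu 1 rho
| boolean_powerS (n : nat) (nu rho : probability R R) :
    is_boolean_power mu n nu -> is_boolean_conv nu mu rho ->
    is_boolean_power mu n.+1 rho.

Definition scale_map (R : realType) (c x : R) : R := c * x.

Lemma measurable_scale_map (R : realType) (c : R) :
  measurable_fun setT (scale_map c).
Proof. exact: mulrl_measurable. Qed.

HB.instance Definition _ (R : realType) (c : R) :=
  isMeasurableFun.Build _ _ _ _ (scale_map c) (measurable_scale_map c).

Definition dilation (R : realType) (c : R) (mu : probability R R) :
    probability R R :=
  distribution mu (scale_map c).

Definition rademacher (R : realType) (A : set R) : \bar R :=
  ((2^-1)%:E * \d_((-1)%R : R) A + (2^-1)%:E * \d_(1%R : R) A)%E.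

Lemma rademacher_measure_addE (R : realType) :
  @rademacher R = measure_add (mscale (2^-1 : R)%:nng (@dirac _ R (-1) R))
                              (mscale (2^-1 : R)%:nng (@dirac _ R 1 R)).
Proof. by apply/funext => A; rewrite measure_addE. Qed.

Lemma rademacher0 (R : realType) : @rademacher R set0 = 0%E.
Proof. by rewrite rademacher_measure_addE; exact: measure0. Qed.

Lemma rademacher_ge0 (R : realType) (A : set R) : (0 <= rademacher A)%E.
Proof. by rewrite rademacher_measure_addE; exact: measure_ge0. Qed.

Lemma rademacher_sigma_additive (R : realType) :
  semi_sigma_additive (@rademacher R).
Proof.
by rewrite rademacher_measure_addE; exact: measure_semi_sigma_additive.
Qed.

HB.instance Definition _ (R : realType) :=
  isMeasure.Build _ R R (@rademacher R) (@rademacher0 R) (@rademacher_ge0 R)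
    (@rademacher_sigma_additive R).

Lemma rademacher_setT (R : realType) : @rademacher R setT = 1%E.
Proof.
rewrite /rademacher !diracT !mule1 -EFinD.
by congr (_%:E); rewrite [RHS](splitr 1) !mul1r.
Qed.

HB.instance Definition _ (R : realType) :=
  Measure_isProbability.Build _ R R (@rademacher R) (@rademacher_setT R).

Definition is_coupling (R : realType) (mu nu : probability R R)
    (pi : probability (R * R)%type R) : Prop :=
  forall A : set R, measurable A ->
    pushforward pi fst A = mu A /\ pushforward pi snd A = nu A.

Definition wasserstein1 (R : realType) (mu nu : probability R R) : \bar R :=
  ereal_inf [set \int[pi]_p `|p.1 - p.2|%:E
            | pi in [set pi | is_coupling mu nu pi]]%E.

(* Main.v *)
(* Evaluating K_rho = n K_mu at z = iy gives a linear system for the damped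
   moments of rho = mu^{uplus n}; letting y -> oo shows that m_1(rho) = 0,
   m_2(rho) = n and m_4(rho) = n (m_4(mu) + n - 1), so that the dilation mu_n
   is centred with int (x^2 - 1)^2 dmu_n = (m_4(mu) - 1) / n.  By
   Cauchy-Schwarz it remains to see that W_1(nu, b) <= int |x^2 - 1| dnu for a
   centred nu.  A coupling of nu with b amounts to the probability p(x) of going
   to 1.  If c(x) := max(-1, min(1, x)) has mean 0 under nu, p = (1 + c) / 2
   does it; otherwise p or 1 - p is rescaled, and the extra cost is at most
   |int c dnu|, which centring turns into an integral over |x| > 1. *)

Require Import Defs.
From HB Require Import structures.
From mathcomp Require Import all_boot all_order all_algebra.
From mathcomp Require Import complex ring lra.
From mathcomp Require Import all_classical all_reals all_analysis.
From mathcomp Require Import measurable_realfun.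

Set Implicit Arguments.
Unset Strict Implicit.
Unset Printing Implicit Defensive.

Import Order.TTheory GRing.Theory Num.Theory.
Import numFieldNormedType.Exports.

Local Open Scope classical_set_scope.
Local Open Scope ring_scope.

(** * Couplings with a two-point law *)

(** The coupling is the image of [nu] times the uniform law on [0, 1] under (x, u) -> (x, 1 if u < p
    x, else -1), so that x is sent to 1 with probability [p x]. The integration formula for
    nonnegative f yields the marginals (f an indicator) as well as the cost (f a distance). *)
Lemma two_point_coupling (R : realType) (nu : probability R R) (p : R -> R)
    (mp : measurable_fun setT p) (p01 : forall x, 0 <= p x <= 1) :
  exists pi : probability (R * R)%type R, forall f : R * R -> \bar R,
    measurable_fun setT f -> (forall z, 0 <= f z)%E ->
    (\int[pi]_z f z = \int[nu]_x ((p x)%:E * f (x, 1%R)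
                                  + (1 - p x)%:E * f (x, (-1)%R)))%E.
Proof.
pose U : probability (measurableTypeR R) R := uniform_prob (@ltr01 R).
pose T (z : R * measurableTypeR R) : R * R := (z.1, if z.2 < p z.1 then 1 else -1).
have mT : measurable_fun setT T.
  apply: measurable_fun_pair => //.
  apply: measurable_fun_ifT => //.
  apply: measurable_fun_ltr => //.
  exact: measurableT_comp.
(* The inner integral over u: [0, 1] is cut at [p x], into pieces of length [p x] and [1 - p x]. *)
have intU (x : R) (c d : \bar R) : (0 <= c)%E -> (0 <= d)%E ->
    (\int[U]_u (if (u < p x)%R then c else d) = (p x)%:E * c + (1 - p x)%:E * d)%E.
  move=> c0 d0; have /andP[px0 px1] := p01 x.
  rewrite integral_uniform//; last 2 first.
  - by apply: measurable_fun_ifT => //; exact: measurable_fun_ltr.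
  - by move=> u; case: ifP.
  rewrite subr0 invr1 mul1e.
  rewrite (@itv_bndbnd_setU _ _ _ (BLeft (p x))) ?bnd_simp//.
  rewrite ge0_integral_setU//=; last 3 first.
  - apply: measurable_funTS; apply: measurable_fun_ifT => //.
    exact: measurable_fun_ltr.
  - by move=> u _; case: ifP.
  - rewrite disj_set2E; apply/eqP; rewrite -subset0 => u /=.
    rewrite !in_itv/= => -[/andP[_ h1] /andP[h2 _]].
    by move: (lt_le_trans h1 h2); rewrite ltxx.
  rewrite (eq_integral (cst c)); last first.
    by move=> u; rewrite inE/= in_itv/= => /andP[_ ->].
  rewrite [X in (_ + X)%E](eq_integral (cst d)); last first.
    by move=> u; rewrite inE/= in_itv/= => /andP[h _]; rewrite ltNge h.
  rewrite !integral_cst//= !lebesgue_measure_itv/= !lte_fin.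
  congr (_ + _)%E; rewrite muleC; congr (_ * _)%E.
    by case: ltP => [_|h]; [rewrite -EFinB subr0|congr (_%:E); lra].
  by case: ltP => [_|h]; [rewrite -EFinB|congr (_%:E); lra].
have nuU1 : (nu \x U)%E setT = 1%E.
  rewrite -setXTT product_measure1E// -[RHS]mule1.
  by congr (_ * _)%E; exact: probability_setT.
pose nuU : probability (R * measurableTypeR R)%type R :=
  HB.pack (nu \x U)%E (Measure_isProbability.Build _ _ _ (nu \x U)%E nuU1).
pose T' : {mfun (R * measurableTypeR R)%type >-> (R * R)%type} :=
  HB.pack T (isMeasurableFun.Build _ _ _ _ T mT).
exists (distribution nuU T') => f mf f0.
rewrite ge0_integral_distribution// fubini_tonelli1; last 2 first.
- exact: measurableT_comp mf mT.
- by move=> z; exact: f0.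
apply: eq_integral => x _; rewrite /fubini_F /=.
under eq_integral => u _ do rewrite /T /= (fun_if (fun v => f (x, v))).
exact: intU.
Qed.

(** The mean 1/2 of [p] makes the second marginal of the two-point coupling Rademacher; the
    right-hand side is the cost of that coupling. *)
Lemma wasserstein1_rademacher_split (R : realType) (nu : probability R R) (p : R -> R)
    (mp : measurable_fun setT p) (p01 : forall x, 0 <= p x <= 1) :
  (\int[nu]_x (p x)%:E = (2^-1)%:E)%E ->
  (wasserstein1 nu (@rademacher R)
   <= \int[nu]_x (p x * `|x - 1| + (1 - p x) * `|x + 1|)%:E)%E.
Proof.
move=> p2; have [pi piE] := two_point_coupling nu mp p01.
have p0 x : 0 <= p x by have /andP[] := p01 x.
have q0 x : 0 <= 1 - p x by rewrite subr_ge0; have /andP[] := p01 x.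
have mq : measurable_fun setT (fun x => 1 - p x) by exact: measurable_funB.
have q2 : (\int[nu]_x (1 - p x)%:E = (2^-1)%:E)%E.
  have : (\int[nu]_x ((p x)%:E + (1 - p x)%:E) = 1)%E.
    under eq_integral => x _ do rewrite -EFinD addrC subrK.
    by rewrite integral_cst// mul1e; exact: probability_setT.
  rewrite ge0_integralD//=; last 4 first.
  - by move=> x _; rewrite lee_fin.
  - exact/measurable_EFinP.
  - by move=> x _; rewrite lee_fin.
  - exact/measurable_EFinP.
  rewrite p2; case: (\int[nu]_x (1 - p x)%:E)%E => // r [] h.
  by congr (_%:E); lra.
(* Indicators in the integration formula give the values of [pi] on measurable sets, from which both
   marginals are read off. *)
have piB B : measurable B -> pi B = (\int[nu]_x (p x * \1_B (x, 1) +
    (1 - p x) * \1_B (x, -1))%:E)%E.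
  move=> mB; rewrite -[in LHS](setIT B) -integral_indic// piE//.
  exact/measurable_EFinP.
apply: ereal_inf_lbound => /=; exists pi.
  move=> A mA; split; rewrite /pushforward piB.
  - have e1 (x c : R) : \1_(fst @^-1` A) (x, c) = \1_A x :> R by rewrite !indicE.
    under eq_integral => x _ do rewrite !e1 -mulrDl addrC subrK mul1r.
    by rewrite integral_indic// setIT.
  - by rewrite -[X in measurable X]setTI; exact: measurable_fst.
  - have e2 (x c : R) : \1_(snd @^-1` A) (x, c) = \1_A c :> R by rewrite !indicE.
    under eq_integral => x _ do rewrite !e2 EFinD !EFinM.
    rewrite ge0_integralD//=; last 4 first.
    + by move=> x _; rewrite -EFinM lee_fin mulr_ge0.
    + by apply/measurable_EFinP/measurable_funM.
    + by move=> x _; rewrite -EFinM lee_fin mulr_ge0.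
    + by apply/measurable_EFinP/measurable_funM.
    rewrite !ge0_integralZr//;
      do ?[exact/measurable_EFinP | by move=> x _; rewrite lee_fin].
    by rewrite p2 q2 /rademacher !diracE !indicE addeC.
  - by rewrite -[X in measurable X]setTI; exact: measurable_snd.
rewrite piE//=; last first.
- apply/measurable_EFinP/measurableT_comp => //; exact: measurable_funB.
- by apply: eq_integral => x _; rewrite opprK.
Qed.

(** * Integrals of real functions under a probability measure *)

Section real_integrable.
Context {R : realType} (mu : probability R R).
Implicit Types f g : R -> R.

Lemma le_integrable_EFin f g : measurable_fun setT f ->
  (forall x, `|f x| <= g x) ->
  mu.-integrable setT (EFin \o g) -> mu.-integrable setT (EFin \o f).
Proof.
move=> mf fg; apply: le_integrable => //; first exact/measurable_EFinP.
by move=> x _ /=; rewrite lee_fin (le_trans (fg x))// ler_norm.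
Qed.

Lemma integrable_EFin_cst (k : R) : mu.-integrable setT (EFin \o (fun=> k)).
Proof. exact: finite_measure_integrable_cst. Qed.

Lemma Rintegral_cstT (k : R) : \int[mu]_x k = k.
Proof.
rewrite Rintegral_cst// -[RHS]mulr1; congr (_ * _).
by rewrite -[RHS]/(fine 1%E); congr fine; exact: probability_setT.
Qed.

Lemma integrable_EFinD f g : mu.-integrable setT (EFin \o f) ->
  mu.-integrable setT (EFin \o g) ->
  mu.-integrable setT (EFin \o (fun x => f x + g x)).
Proof. by move=> fi gi; exact: integrableD fi gi. Qed.

Lemma integrable_EFinB f g : mu.-integrable setT (EFin \o f) ->
  mu.-integrable setT (EFin \o g) ->
  mu.-integrable setT (EFin \o (fun x => f x - g x)).
Proof. by move=> fi gi; exact: integrableB fi gi. Qed.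

Lemma integrable_EFinZl (k : R) f : mu.-integrable setT (EFin \o f) ->
  mu.-integrable setT (EFin \o (fun x => k * f x)).
Proof. by move=> fi; exact: integrableZl fi. Qed.

Lemma integrable_of_sqr f : measurable_fun setT f ->
  mu.-integrable setT (EFin \o (fun x => f x ^+ 2)) ->
  mu.-integrable setT (EFin \o f).
Proof.
move=> mf if2; apply: (le_integrable_EFin (g := fun x => 1 + f x ^+ 2)) => //.
  by move=> x; case: (ler0P (f x)) => ?; nra.
exact: integrable_EFinD (integrable_EFin_cst _) if2.
Qed.

Lemma EFin_Rintegral f : mu.-integrable setT (EFin \o f) ->
  (\int[mu]_x (f x)%:E)%E = (\int[mu]_x f x)%:E.
Proof. by move=> fi; rewrite /Rintegral fineK//; exact: integrable_fin_num. Qed.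

End real_integrable.

(** * Distance from a centred law to the Rademacher law *)

(** The cost of a suitable coupling is at most [|x ^+ 2 - 1|] plus a correction [r], pointwise in x;
    centring makes the integral of [r] vanish. *)
Lemma wasserstein1_rademacher_le (R : realType) (nu : probability R R) :
  nu.-integrable setT (EFin \o (fun x : R => x ^+ 2)) ->
  \int[nu]_x x = 0 ->
  (wasserstein1 nu (@rademacher R) <= (\int[nu]_x `|x ^+ 2 - 1|)%:E)%E.
Proof.
move=> i2 x0.
have i1 : nu.-integrable setT (EFin \o (fun x : R => x)).
  by exact: integrable_of_sqr.
pose c (x : R) := Num.max (-1) (Num.min 1 x).
have mc : measurable_fun setT c.
  by apply: measurable_maxr => //; exact: measurable_minr.
have cP x : [\/ x <= -1 /\ c x = -1, -1 <= x <= 1 /\ c x = x | 1 <= x /\ c x = 1].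
  rewrite /c; case: (leP 1 x) => h1.
    by apply: Or33; split => //; apply/max_idPr; lra.
  case: (leP (-1) x) => h2; last by apply: Or31; split => //; lra.
  by apply: Or32; split => //; lra.
have ic : nu.-integrable setT (EFin \o c).
  apply: (le_integrable_EFin (g := fun=> 1)) => //; last exact: integrable_EFin_cst.
  by move=> x; rewrite ler_norml; case: (cP x) => -[h ->]; lra.
have ia : nu.-integrable setT (EFin \o (fun x : R => `|x ^+ 2 - 1|)).
  apply: (le_integrable_EFin (g := fun x => 1 + x ^+ 2)) => //.
  - by apply: measurableT_comp => //; exact: measurable_funB.
  - by move=> x; rewrite normr_id; case: (ler0P (x ^+ 2 - 1)) => ?; nra.
  - exact: integrable_EFinD (integrable_EFin_cst _ _) i2.
pose m := \int[nu]_x c x.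
(* [e] is a sign of the mean [m] of [c]; it lets the two rescalings, of p and of 1 - p, be treated
   together. *)
have [e [e1 em]] : exists e : R, (e = 1 \/ e = -1) /\ 0 <= e * m.
  by case: (leP 0 m) => h; [exists 1|exists (-1)]; split; [left| |right|] => //; lra.
have ee : e * e = 1 by case: e1 => ->; ring.
(* For e = 1, p = (1 - t) (1 + c) / 2; for e = -1, 1 - p = (1 - t) (1 - c) / 2. *)
pose s := e * m; pose t := s / (1 + s).
have t0 : 0 <= t by rewrite divr_ge0// addr_ge0.
(* Equivalently (1 - t) (1 + s) = 1: the factor 1 - t brings the mean (1 + s) / 2 of (1 + e c) / 2
   back to 1/2. *)
have ts : t * (1 + s) = s by rewrite divfK// gt_eqF// ltr_pwDl.
have t1 : t <= 1 by rewrite ler_pdivrMr ?mul1r ?ltr_pwDl// lerDr.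
have Eaff (u v : R) : \int[nu]_x (u + v * c x) = u + v * m.
  rewrite RintegralD ?Rintegral_cstT ?RintegralZl//; first exact: integrable_EFin_cst.
  exact: integrable_EFinZl.
have iaff (u v : R) : nu.-integrable setT (EFin \o (fun x => u + v * c x)).
  by apply: integrable_EFinD; [exact: integrable_EFin_cst|exact: integrable_EFinZl].
pose u := (1 - e * t) / 2; pose v := (1 - t) / 2.
pose p x := u + v * c x.
have p01 x : 0 <= p x <= 1.
  rewrite /p /u /v.
  have c1 : -1 <= c x <= 1 by case: (cP x) => -[h ->]; lra.
  by case: e1 => ->; nra.
have mp : measurable_fun setT p.
  by apply: measurable_funD => //; apply: measurable_funM.
have p2 : (\int[nu]_x (p x)%:E = (2^-1)%:E)%E.
  rewrite (EFin_Rintegral (iaff u v)) Eaff; congr (_%:E).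
  rewrite /u /v; have : m = e * s by rewrite /s mulrA ee mul1r.
  move=> ->; move: ts; clearbody t s.
  by case: e1 => ->; lra.
apply: (le_trans (wasserstein1_rademacher_split mp p01 p2)).
(* r has integral 0: t (1 + e c) integrates to s, and so does e (c - x). *)
pose r x := (t + (e * t - e) * c x) + e * x.
have ir : nu.-integrable setT (EFin \o r).
  by apply: integrable_EFinD; [exact: iaff|exact: integrable_EFinZl].
have r0 : \int[nu]_x r x = 0.
  rewrite (RintegralD measurableT (iaff t (e * t - e))); last exact: integrable_EFinZl.
  rewrite Eaff RintegralZl// x0 mulr0 addr0.
  rewrite (_ : t + _ = t * (1 + s) - s); last by rewrite /s; ring.
  by rewrite ts subrr.
(* On [-1, 1] the slack is exactly t (1 - x^2). Outside, it is x^2 - 1 where x has the sign [e], and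
   (|x| - 1)^2 on the opposite side. *)
have le_cost x : p x * `|x - 1| + (1 - p x) * `|x + 1| <= `|x ^+ 2 - 1| + r x.
  rewrite /p /u /v /r; case: (cP x) => -[h ->].
  - rewrite (ler0_norm (_ : x - 1 <= 0)); last lra.
    rewrite (ler0_norm (_ : x + 1 <= 0)); last lra.
    rewrite ger0_norm; last nra.
    by case: e1 => ->; nra.
  - rewrite (ler0_norm (_ : x - 1 <= 0)); last lra.
    rewrite (ger0_norm (_ : 0 <= x + 1)); last lra.
    rewrite ler0_norm; last nra.
    have : 0 <= t * ((1 - x) * (1 + x)) by rewrite mulr_ge0// mulr_ge0//; lra.
    by case: e1 => ->; nra.
  - rewrite (ger0_norm (_ : 0 <= x - 1)); last lra.
    rewrite (ger0_norm (_ : 0 <= x + 1)); last lra.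
    rewrite ger0_norm; last nra.
    by case: e1 => ->; nra.
rewrite -[X in (_ <= X)%E]/(_%:E).
have -> : \int[nu]_x `|x ^+ 2 - 1| = \int[nu]_x (`|x ^+ 2 - 1| + r x).
  by rewrite RintegralD// r0 addr0.
rewrite -EFin_Rintegral; last exact: integrable_EFinD.
apply: ge0_le_integral => //.
- move=> x _; rewrite lee_fin; have /andP[h1 h2] := p01 x.
  by rewrite addr_ge0// mulr_ge0// subr_ge0.
- apply/measurable_EFinP; apply: measurable_funD; apply: measurable_funM => //.
  + by apply: measurableT_comp => //; exact: measurable_funB.
  + exact: measurable_funB.
  + by apply: measurableT_comp => //; exact: measurable_funD.
- exact: measurable_int (integrable_EFinD ia ir).
- by move=> x _; rewrite lee_fin; exact: le_cost.
Qed.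

Lemma Rintegral_norm_le_sqrt (R : realType) (mu : probability R R) (f : R -> R) :
  measurable_fun setT f -> mu.-integrable setT (EFin \o (fun x => f x ^+ 2)) ->
  \int[mu]_x `|f x| <= Num.sqrt (\int[mu]_x f x ^+ 2).
Proof.
move=> mf if2.
have mnf : measurable_fun setT (fun x => `|f x|) by exact: measurableT_comp.
have inf : mu.-integrable setT (EFin \o (fun x => `|f x|)).
  apply: integrable_of_sqr => //.
  by under eq_fun do rewrite /= real_normK ?num_real//.
set A := \int[mu]_x `|f x|.
have A0 : 0 <= A by exact: Rintegral_ge0.
rewrite -(ger0_norm A0) -sqrtr_sqr ler_sqrt; last first.
  by apply: Rintegral_ge0 => x _; exact: sqr_ge0.
rewrite -subr_ge0.
(* The difference is the variance of |f|, that is the integral of (|f| - A)^2, here in expanded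
   form. *)
have -> : \int[mu]_x f x ^+ 2 - A ^+ 2
    = \int[mu]_x (f x ^+ 2 + (A ^+ 2 + (- (2 * A)) * `|f x|)).
  have i3 := integrable_EFinZl (- (2 * A)) inf.
  rewrite (RintegralD measurableT if2 (integrable_EFinD (integrable_EFin_cst mu _) i3)).
  rewrite (RintegralD measurableT (integrable_EFin_cst mu (A ^+ 2)) i3).
  by rewrite Rintegral_cstT RintegralZl// -/A; ring.
apply: Rintegral_ge0 => x _; rewrite -(real_normK (num_real (f x))).
by have := sqr_ge0 (`|f x| - A); nra.
Qed.

(** * The damping factor and its integrals *)

(* The real part of z G(z), at z = iy, for the Dirac mass at x. *)
Definition damp (R : realType) (y x : R) : R := y ^+ 2 / (x ^+ 2 + y ^+ 2).

Section damp.
Context {R : realType}.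
Implicit Types x y : R.

Lemma damp_den_gt0 y x : 0 < y -> 0 < x ^+ 2 + y ^+ 2.
Proof. by move=> y0; rewrite ltr_wpDl// ?sqr_ge0// exprn_gt0. Qed.

Lemma damp_gt0 y x : 0 < y -> 0 < damp y x.
Proof. by move=> y0; rewrite divr_gt0 ?damp_den_gt0// exprn_gt0. Qed.

Lemma damp_le1 y x : 0 < y -> damp y x <= 1.
Proof.
by move=> y0; rewrite ler_pdivrMr ?damp_den_gt0// mul1r lerDr sqr_ge0.
Qed.

Lemma sqr_damp_le y x : 0 < y -> x ^+ 2 * damp y x <= y ^+ 2.
Proof.
move=> y0; rewrite mulrA ler_pdivrMr ?damp_den_gt0//.
by have := sqr_ge0 (y ^+ 2); nra.
Qed.

Lemma le_damp y1 y2 x : 0 < y1 -> y1 <= y2 -> damp y1 x <= damp y2 x.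
Proof.
move=> y10 y12.
have y20 := lt_le_trans y10 y12.
rewrite ler_pdivrMr ?damp_den_gt0// mulrAC ler_pdivlMr ?damp_den_gt0//.
have : y1 ^+ 2 <= y2 ^+ 2 by rewrite ler_sqr// nnegrE ltW.
by have := sqr_ge0 x; nra.
Qed.

Lemma damp_ge y x : 0 < y -> 1 - x ^+ 2 / y ^+ 2 <= damp y x.
Proof.
move=> y0; have y20 : 0 < y ^+ 2 by rewrite exprn_gt0.
rewrite ler_pdivlMr ?damp_den_gt0// mulrBl mul1r.
rewrite lerBlDr -lerBlDl addrK mulrAC ler_pdivlMr//.
by have := sqr_ge0 (x ^+ 2); nra.
Qed.

Lemma measurable_damp y : 0 < y -> measurable_fun setT (damp y).
Proof.
move=> y0; apply: continuous_measurable_fun => x.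
apply: cvgM; first exact: cvg_cst.
apply: cvgV; first by rewrite gt_eqF// damp_den_gt0.
by apply: cvgD; [exact: exprn_continuous|exact: cvg_cst].
Qed.

Lemma cvg_damp x : damp k.+1%:R x @[k --> \oo] --> (1 : R).
Proof.
apply: (@squeeze_cvgr _ _ _ _ (fun k => 1 - x ^+ 2 * k.+1%:R^-1) (cst 1)).
- near=> k; rewrite damp_le1// andbT (le_trans _ (damp_ge _ _))//.
  rewrite lerD2l lerN2 ler_wpM2l ?sqr_ge0// lef_pV2 ?posrE ?exprn_gt0//.
  by rewrite expr2 ler_peMl// ler1n.
- rewrite -[X in _ --> X]subr0; apply: cvgB; first exact: cvg_cst.
  by rewrite -(mulr0 (x ^+ 2)); apply: cvgM; [exact: cvg_cst|exact: cvg_harmonic].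
- exact: cvg_cst.
Unshelve. all: by end_near. Qed.

End damp.

Section damp_integral.
Context {R : realType} (mu : probability R R).
Implicit Types (f : R -> R) (y l : R).

Lemma integrable_damp f y : 0 < y -> mu.-integrable setT (EFin \o f) ->
  mu.-integrable setT (EFin \o (fun x => f x * damp y x)).
Proof.
move=> y0 fi; have mf : measurable_fun setT f.
  by apply/measurable_EFinP; exact: measurable_int fi.
apply: le_integrable fi => //.
  by apply/measurable_EFinP/measurable_funM => //; exact: measurable_damp.
move=> x _ /=; rewrite lee_fin normrM ler_piMr//.
by rewrite ger0_norm ?damp_le1// ltW// damp_gt0.
Qed.

(** Dominated convergence, since [damp] lies between 0 and 1 and tends to 1. The index [k.+1] keeps
    y positive. *)
Lemma cvg_Rintegral_damp f : mu.-integrable setT (EFin \o f) ->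
  \int[mu]_x (f x * damp k.+1%:R x) @[k --> \oo] --> \int[mu]_x f x.
Proof.
move=> fi; have mf : measurable_fun setT (EFin \o f) by exact: measurable_int fi.
pose g (k : nat) (x : R) := (f x * damp k.+1%:R x)%:E.
have mg k : measurable_fun setT (g k).
  exact: measurable_int (integrable_damp (ltr0Sn _ _) fi).
have [] := @dominated_convergence _ _ _ mu setT measurableT g (EFin \o f)
  (fun x => `|f x|%:E) mg mf.
- apply: aeW => x _ /=; apply: cvg_EFin; first exact: nearW.
  rewrite -[X in _ --> X]mulr1; apply: cvgM; [exact: cvg_cst|exact: cvg_damp].
- by have := integrable_abse fi.
- apply: aeW => x k _; rewrite /g abse_EFin lee_fin normrM ler_piMr//.
  by rewrite ger0_norm ?damp_le1// ltW// damp_gt0.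
move=> _ _ h; apply: fine_cvg.
by rewrite fineK//; exact: integrable_fin_num.
Qed.

(** Monotone convergence, [damp] being nondecreasing in y. Integrability of f is part of the
    conclusion: this is how the second and fourth moments of the Boolean power are shown to be
    finite. *)
Lemma Rintegral_damp_lim f l : measurable_fun setT f -> (forall x, 0 <= f x) ->
  (forall k, mu.-integrable setT (EFin \o (fun x => f x * damp k.+1%:R x))) ->
  \int[mu]_x (f x * damp k.+1%:R x) @[k --> \oo] --> l ->
  mu.-integrable setT (EFin \o f) /\ \int[mu]_x f x = l.
Proof.
move=> mf f0 fi fl.
pose g (k : nat) (x : R) := (f x * damp k.+1%:R x)%:E.
have gl : (\int[mu]_x g k x)%E @[k --> \oo] --> l%:E.
  have -> : (fun k => \int[mu]_x g k x)%E
      = EFin \o (fun k => \int[mu]_x (f x * damp k.+1%:R x)).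
    by apply/funext => k /=; rewrite -EFin_Rintegral.
  by apply: cvg_EFin; [exact: nearW|exact: fl].
have limg x : limn (g ^~ x) = (f x)%:E.
  apply/cvg_lim => //; apply: cvg_EFin; first exact: nearW.
  rewrite -[X in _ --> X]mulr1; apply: cvgM; [exact: cvg_cst|exact: cvg_damp].
have gf : (\int[mu]_x g k x)%E @[k --> \oo] --> (\int[mu]_x (f x)%:E)%E.
  rewrite (eq_integral (fun x => limn (g ^~ x))); last first.
    by move=> x _; rewrite limg.
  apply: (cvg_monotone_convergence measurableT).
  - by move=> k; exact: measurable_int (fi k).
  - by move=> k x _; rewrite lee_fin mulr_ge0// ltW// damp_gt0.
  - move=> x _ k1 k2 k12; rewrite lee_fin ler_wpM2l// le_damp//.
    by rewrite ler_nat.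
have e : (\int[mu]_x (f x)%:E)%E = l%:E by exact: cvg_unique gf gl.
split; last by rewrite /Rintegral e.
apply/integrableP; split; first exact/measurable_EFinP.
under eq_integral => x _ do rewrite /= ger0_norm//.
by rewrite e ltry.
Qed.

(** A positive function of integral zero would make the whole line a null set. This keeps the Cauchy
    transform away from 0 on the imaginary axis, so that it can be inverted. *)
Lemma Rintegral_damp_gt0 y : 0 < y -> 0 < \int[mu]_x damp y x.
Proof.
move=> y0; have md := measurable_damp y0.
have di : mu.-integrable setT (EFin \o damp y).
  apply: (le_integrable_EFin (g := fun=> 1)) => //; last exact: integrable_EFin_cst.
  by move=> x; rewrite ger0_norm ?damp_le1// ltW// damp_gt0.
rewrite lt0r Rintegral_ge0 ?andbT; last by move=> x _; rewrite ltW// damp_gt0.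
apply/negP => /eqP e0.
have : (\int[mu]_x `|(EFin \o damp y) x| = 0)%E.
  under eq_integral => x _ do rewrite /= ger0_norm ?(ltW (damp_gt0 _ y0))//.
  by rewrite EFin_Rintegral// e0.
move/ae_eq_integral_abs => /(_ measurableT).
have mE : measurable_fun setT (EFin \o damp y) by exact/measurable_EFinP.
move=> /(_ mE) [N [mN N0 TN]].
have : (mu setT <= mu N)%E.
  apply: le_measure; rewrite ?inE// => x _; apply: TN => /=.
  move=> /(_ I) [] /eqP; rewrite gt_eqF//; exact: damp_gt0.
by rewrite N0 probability_setT lee_fin; lra.
Qed.

End damp_integral.

(** * Cauchy transforms on the imaginary axis *)

Section transforms.
Local Open Scope complex_scope.

Lemma cauchy_transform_imaginary (R : realType) (mu : probability R R) (y : R) :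
  0 < y -> cauchy_transform mu (0 +i* y) =
    (- (y ^- 2 * \int[mu]_x (x * damp y x)))
    +i* (- (y^-1 * \int[mu]_x damp y x)).
Proof.
move=> y0; have yn0 : y != 0 by rewrite gt_eqF.
have dn0 x : x ^+ 2 + y ^+ 2 != 0 by rewrite gt_eqF// damp_den_gt0.
have i0 : mu.-integrable setT (EFin \o damp y).
  have := integrable_damp y0 (integrable_EFin_cst mu 1).
  by under eq_fun do rewrite /= mul1r.
have i1 : mu.-integrable setT (EFin \o (fun x => x * damp y x)).
  (* The bound comes from |x| <= 1 + x^2, [damp] <= 1 and x^2 [damp] <= y^2. *)
  apply: (le_integrable_EFin (g := fun x => 1 + y ^+ 2));
    last exact: integrable_EFin_cst.
    by apply: measurable_funM => //; exact: measurable_damp.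
  move=> x; rewrite normrM (ger0_norm (ltW (damp_gt0 _ y0))).
  have := sqr_damp_le x y0; have := damp_le1 x y0; have := damp_gt0 x y0.
  move: (damp y x) => d d0 d1 xd.
  have : `|x| * d <= (1 + x ^+ 2) * d.
    by rewrite ler_wpM2r ?ltW//; case: (ler0P x) => ?; nra.
  by nra.
rewrite /cauchy_transform; congr (_ +i* _).
- rewrite -mulNr -RintegralZl//; apply: eq_Rintegral => x _.
  by rewrite mul1r /= /damp; field; rewrite dn0 yn0.
- rewrite -mulNr -RintegralZl//; apply: eq_Rintegral => x _.
  by rewrite mul1r /= /damp; field; rewrite dn0 yn0.
Qed.

Lemma boolean_power_K (R : realType) (mu rho : probability R R) (n : nat) :
  is_boolean_power mu n rho ->
  forall z : R[i], 0 < complex.Im z -> K_transform rho z = n%:R * K_transform mu z.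
Proof.
move=> H; elim: {n rho} H => [rho e z _|n nu rho _ IH H z z0].
  rewrite mul1r /K_transform /cauchy_transform /Rintegral.
  congr (_ - 1 / (fine _ +i* fine _));
    by apply: eq_measure_integral => A mA _; exact: e.
by rewrite H// IH// -natr1 mulrDl mul1r.
Qed.

(** With z = iy, clearing denominators in z - 1/G' = N (z - 1/G) gives G = G' (N - (N - 1) z G); the
    two conclusions are its real and imaginary parts, linear in the unknowns [q'] and [P']. *)
Lemma cauchy_transform_system (R : realType) (N y q P q' P' : R) :
  0 < y -> P != 0 -> P' != 0 ->
  let G := (- (y ^- 2 * q)) +i* (- (y^-1 * P)) in
  let G' := (- (y ^- 2 * q')) +i* (- (y^-1 * P')) in
  (0 +i* y) - 1 / G' = N%:C * ((0 +i* y) - 1 / G) ->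
  q = q' * (N - (N - 1) * P) - (N - 1) * q * P' /\
  P = P' * (N - (N - 1) * P) + (N - 1) * q * q' / y ^+ 2.
Proof.
move=> y0 P0 P'0 G G'.
have yn0 : y != 0 by rewrite gt_eqF.
have G0 : G != 0.
  by rewrite eq_complex /= negb_and orbC oppr_eq0 mulf_neq0// invr_eq0.
have G'0 : G' != 0.
  by rewrite eq_complex /= negb_and orbC oppr_eq0 mulf_neq0// invr_eq0.
move=> H.
have alg (z c : R[i]) (g g' : R[i]) : g != 0 -> g' != 0 ->
    z - 1 / g' = c * (z - 1 / g) -> g = g' * (c - (c - 1) * z * g).
  move=> g0 g'0 h; have {}h : g'^-1 = z - c * (z - 1 / g) by rewrite -h; field.
  have -> : c - (c - 1) * z * g = g * (z - c * (z - 1 / g)) by field.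
  by rewrite -h mulrCA mulfV// mulr1.
have := alg _ _ _ _ G0 G'0 H.
rewrite /G /G'; move/eqP; rewrite eq_complex /=; simpc => /andP[/eqP h1 /eqP h2].
split.
- apply: (mulfI (_ : y ^- 2 != 0)); first by rewrite invr_eq0 expf_neq0.
  by apply: oppr_inj; rewrite h1; field.
- apply: (mulfI (_ : y^-1 != 0)); first by rewrite invr_eq0.
  by apply: oppr_inj; rewrite h2; field.
Qed.

End transforms.

(** * Expansion of damped moments in powers of 1/y *)

Section damped_moments.
Context {R : realType} (mu : probability R R).

Lemma integrable_sqr_damp y : 0 < y ->
  mu.-integrable setT (EFin \o (fun x => x ^+ 2 * damp y x)).
Proof.
move=> y0.
apply: (le_integrable_EFin (g := fun=> y ^+ 2)); last exact: integrable_EFin_cst.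
  by apply: measurable_funM => //; exact: measurable_damp.
move=> x; rewrite ger0_norm ?sqr_damp_le// mulr_ge0 ?sqr_ge0//.
by rewrite ltW// damp_gt0.
Qed.

(** Integrates the identity 1 - damp = x^2 damp / y^2, an exact expansion with the damped second
    moment as remainder. *)
Lemma Rintegral_damp_expand y : 0 < y ->
  \int[mu]_x damp y x = 1 - y ^- 2 * \int[mu]_x (x ^+ 2 * damp y x).
Proof.
move=> y0; have i2 := integrable_sqr_damp y0.
rewrite -RintegralZl// -[X in _ = X - _](Rintegral_cstT mu).
rewrite -RintegralB//; [|exact: integrable_EFin_cst|exact: integrable_EFinZl].
apply: eq_Rintegral => x _; rewrite /damp; field.
by rewrite !gt_eqF ?damp_den_gt0.
Qed.

Lemma integrable_expr4_damp y : 0 < y ->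
  mu.-integrable setT (EFin \o (fun x => x ^+ 2)) ->
  mu.-integrable setT (EFin \o (fun x => x ^+ 4 * damp y x)).
Proof.
move=> y0 i2; apply: (le_integrable_EFin (g := fun x => y ^+ 2 * x ^+ 2)).
- by apply: measurable_funM; [exact: measurable_funX|exact: measurable_damp].
- move=> x; rewrite ger0_norm; last first.
    by rewrite mulr_ge0 ?exprn_even_ge0// ltW// damp_gt0.
  rewrite (_ : x ^+ 4 = x ^+ 2 * x ^+ 2); last by rewrite -exprD.
  by rewrite mulrAC ler_wpM2r ?sqr_ge0// sqr_damp_le.
- exact: integrable_EFinZl.
Qed.

(** The identity 1 - damp = x^2 damp / y^2 again, multiplied by x^2. *)
Lemma Rintegral_sqr_damp_expand y : 0 < y ->
  mu.-integrable setT (EFin \o (fun x => x ^+ 2)) ->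
  \int[mu]_x (x ^+ 2 * damp y x) =
  \int[mu]_x x ^+ 2 - y ^- 2 * \int[mu]_x (x ^+ 4 * damp y x).
Proof.
move=> y0 i2; have i4 := integrable_expr4_damp y0 i2.
rewrite -RintegralZl// -RintegralB//; last exact: integrable_EFinZl.
apply: eq_Rintegral => x _; rewrite /damp; field.
by rewrite !gt_eqF ?damp_den_gt0.
Qed.

(** By centring, x damp may be replaced by x damp - x = - x^3 damp / y^2, so the damped mean is
    O(1/y^2) and survives multiplication by y. *)
Lemma cvg_mul_Rintegral_id_damp :
  mu.-integrable setT (EFin \o (fun x => x ^+ 4)) ->
  \int[mu]_x x = 0 ->
  (k.+1%:R * \int[mu]_x (x * damp k.+1%:R x)) @[k --> \oo] --> (0 : R).
Proof.
move=> i4 x0.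
have i2 : mu.-integrable setT (EFin \o (fun x => x ^+ 2)).
  by apply: integrable_of_sqr => //; under eq_fun do rewrite /= -exprM.
have i1 : mu.-integrable setT (EFin \o (fun x => x)) by exact: integrable_of_sqr.
pose C := \int[mu]_x (x ^+ 2 + x ^+ 4).
have bnd k : `|k.+1%:R * \int[mu]_x (x * damp k.+1%:R x)| <= C * k.+1%:R^-1.
  have y0 : 0 < k.+1%:R :> R by [].
  move: (k.+1%:R) y0 => y y0.
  have id := integrable_damp y0 i1.
  rewrite -[X in `|_ * X|]subr0 -x0 -RintegralB//.
  rewrite -RintegralZl//; last exact: integrable_EFinB.
  have ib := integrable_EFinZl y (integrable_EFinB id i1).
  apply: (le_trans (le_normr_Rintegral _ ib)) => //.
  have i24 := integrable_EFinD i2 i4.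
  rewrite mulrC -RintegralZl//; apply: le_Rintegral => //.
  - by have := integrable_abse ib.
  - exact: integrable_EFinZl.
  move=> x _.
  have -> : y * (x * damp y x - x) = - (x ^+ 3 * (y^-1 * damp y x)).
    by rewrite /damp; field; rewrite !gt_eqF ?damp_den_gt0.
  rewrite normrN normrM mulrC (ger0_norm (_ : 0 <= _ * damp y x)); last first.
    by rewrite mulr_ge0// ltW// ?invr_gt0// damp_gt0.
  rewrite -mulrA ler_wpM2l ?invr_ge0 ?(ltW y0)//.
  (* With t = |x|, this follows from t^2 (t - 1)^2 >= 0. *)
  have h : `|x ^+ 3| <= x ^+ 2 + x ^+ 4.
    rewrite normrX -[x ^+ 2]real_normK ?num_real//.
    rewrite (_ : x ^+ 4 = `|x| ^+ 4); last first.
      by rewrite -normrX ger0_norm// exprn_even_ge0.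
    have := normr_ge0 x; move: `|x| => t t0.
    have := mulr_ge0 (sqr_ge0 t) (sqr_ge0 (t - 1)).
    by have := sqr_ge0 (t ^+ 2); have := sqr_ge0 t; nra.
  by rewrite (le_trans _ h)// ler_piMl// damp_le1.
apply/norm_cvg0P; apply: (@squeeze_cvgr _ _ _ _ (cst 0) (fun k => C * k.+1%:R^-1)).
- by near=> k; rewrite normr_ge0/= bnd.
- exact: cvg_cst.
- by rewrite -(mulr0 C); apply: cvgM; [exact: cvg_cst|exact: cvg_harmonic].
Unshelve. all: by end_near. Qed.

End damped_moments.

(** * Moments of a Boolean power *)

Lemma boolean_power_moments (R : realType) (mu rho : probability R R) (N : R) :
  1 <= N ->
  mu.-integrable setT (EFin \o (fun x => x ^+ 4)) ->
  \int[mu]_x x = 0 -> \int[mu]_x x ^+ 2 = 1 ->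
  (forall z : R[i], 0 < complex.Im z ->
    K_transform rho z = (N%:C)%C * K_transform mu z) ->
  [/\ rho.-integrable setT (EFin \o (fun x => x ^+ 4)),
      \int[rho]_x x = 0, \int[rho]_x x ^+ 2 = N &
      \int[rho]_x x ^+ 4 = N * (\int[mu]_x x ^+ 4 + N - 1)].
Proof.
move=> N1 i4 mu1 mu2 HK.
have i2 : mu.-integrable setT (EFin \o (fun x => x ^+ 2)).
  by apply: integrable_of_sqr => //; under eq_fun do rewrite /= -exprM.
have i1 : mu.-integrable setT (EFin \o (fun x => x)) by exact: integrable_of_sqr.
set m4 := \int[mu]_x x ^+ 4.
pose w (k : nat) : R := k.+1%:R ^- 2.
pose a k := \int[mu]_x (x ^+ 2 * damp k.+1%:R x).
pose b k := \int[mu]_x (x ^+ 4 * damp k.+1%:R x).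
pose q k := \int[mu]_x (x * damp k.+1%:R x).
pose a' k := \int[rho]_x (x ^+ 2 * damp k.+1%:R x).
pose q' k := \int[rho]_x (x * damp k.+1%:R x).
(* At z = iy with y = k + 1, [al] + i [be] / y equals N - (N - 1) z G(z) for [mu]. Its squared
   modulus [D] is the determinant of the linear system, and [al] >= 1 keeps it nonzero. *)
pose al k := 1 + (N - 1) * w k * a k.
pose be k := (N - 1) * q k.
pose D k := al k ^+ 2 + w k * be k ^+ 2.
have k0 k : 0 < k.+1%:R :> R by [].
have w0 k : 0 < w k by rewrite invr_gt0 exprn_gt0.
have a0 k : 0 <= a k.
  by apply: Rintegral_ge0 => x _; rewrite mulr_ge0 ?sqr_ge0// ltW// damp_gt0.
have D0 k : D k != 0.
  rewrite gt_eqF// ltr_pwDl//; last by rewrite mulr_ge0 ?sqr_ge0// ltW.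
  by rewrite exprn_gt0// ltr_pwDl// !mulr_ge0// ?subr_ge0// ltW.
(* Cramer's rule, after writing the damped masses of [mu] and [rho] as 1 - w a and 1 - w a'. *)
have [Ha Hq] : (forall k, a' k = N * (al k * a k + be k * q k) / D k) /\
    (forall k, q' k = (al k * q k + be k * (1 - w k * a k)) / D k).
  have sys k : q k = q' k * al k - be k * (1 - w k * a' k) /\
     1 - w k * a k = (1 - w k * a' k) * al k + be k * q' k * w k.
    have : (0 : R) < complex.Im (Complex 0 (k.+1%:R : R)) by [].
    move=> /HK; rewrite /K_transform !cauchy_transform_imaginary//.
    move=> /cauchy_transform_system H.
    have {H} := H (k0 k) (lt0r_neq0 (Rintegral_damp_gt0 mu (k0 k)))
      (lt0r_neq0 (Rintegral_damp_gt0 rho (k0 k))).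
    rewrite !Rintegral_damp_expand// -/(w k) -/(a k) -/(a' k) -/(q k) -/(q' k).
    rewrite (_ : N - (N - 1) * (1 - w k * a k) = al k); last by rewrite /al; ring.
    by rewrite -/(be k).
  split=> k; have [h1 h2] := sys k.
  - apply: (mulfI (lt0r_neq0 (w0 k))); apply: (mulIf (D0 k)).
    rewrite mulrA divfK//.
    have e : (1 - w k * a' k) * D k = al k * (1 - w k * a k) - w k * be k * q k.
      by rewrite h1 h2 /D; ring.
    have -> : w k * a' k * D k = D k - (1 - w k * a' k) * D k by ring.
    by rewrite e /D /be /al; ring.
  - by apply: (mulIf (D0 k)); rewrite divfK// h1 h2 /D; ring.
have cw : w k @[k --> \oo] --> (0 : R).
  have -> : w = fun k => harmonic k * harmonic k.
    by apply/funext => k; rewrite /w /harmonic/= -expr2 exprVn.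
  by rewrite -(mulr0 0); apply: cvgM; exact: cvg_harmonic.
have ca : a k @[k --> \oo] --> (1 : R) by rewrite -mu2; exact: cvg_Rintegral_damp.
have cq : q k @[k --> \oo] --> (0 : R) by rewrite -mu1; exact: cvg_Rintegral_damp.
have cb : b k @[k --> \oo] --> m4 by exact: cvg_Rintegral_damp.
have cyq : k.+1%:R * q k @[k --> \oo] --> (0 : R).
  by exact: cvg_mul_Rintegral_id_damp.
have cal : al k @[k --> \oo] --> (1 : R).
  have -> : (1 : R) = 1 + (N - 1) * 0 * 1 by ring.
  apply: cvgD; first exact: cvg_cst.
  by apply: cvgM => //; apply: cvgM => //; exact: cvg_cst.
have cbe : be k @[k --> \oo] --> (0 : R).
  by rewrite -(mulr0 (N - 1)); apply: cvgM => //; exact: cvg_cst.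
have cD : D k @[k --> \oo] --> (1 : R).
  have -> : (1 : R) = 1 * 1 + 0 * (0 * 0) by ring.
  apply: cvgD; [|apply: cvgM => //]; rewrite /=;
    by under eq_fun do rewrite expr2; exact: cvgM.
have cDV : (D k)^-1 @[k --> \oo] --> (1 : R).
  by rewrite -[X in _ --> X]invr1; apply: cvgV => //; exact: oner_neq0.
have ca' : a' k @[k --> \oo] --> N.
  rewrite [X in _ --> X](_ : N = N * (1 * 1 + 0 * 0) * 1); last by ring.
  under eq_fun do rewrite Ha.
  apply: cvgM => //; apply: cvgM; first exact: cvg_cst.
  by apply: cvgD; exact: cvgM.
have cq' : q' k @[k --> \oo] --> (0 : R).
  rewrite [X in _ --> X](_ : 0 = (1 * 0 + 0 * (1 - 0 * 1)) * 1); last by ring.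
  under eq_fun do rewrite Hq.
  apply: cvgM => //; apply: cvgD; apply: cvgM => //.
  by apply: cvgB; [exact: cvg_cst|exact: cvgM].
have [ir2 rho2] : rho.-integrable setT (EFin \o (fun x => x ^+ 2)) /\
    \int[rho]_x x ^+ 2 = N.
  apply: Rintegral_damp_lim ca' => //.
  - by move=> x; exact: sqr_ge0.
  - by move=> k; exact: integrable_sqr_damp.
(* Only now, with a finite second moment, does x become integrable under [rho], so that the limit of
   [q'] can be identified with the mean. *)
have ir1 : rho.-integrable setT (EFin \o (fun x => x)) by exact: integrable_of_sqr.
have rho1 : \int[rho]_x x = 0.
  by apply: cvg_unique cq' => //; exact: cvg_Rintegral_damp.
(* The damped fourth moment of [rho] is (N - a') / w, so a factor w must be extracted from the
   numerator. It comes from 1 - a = w b and, in the term (N - 1) q^2, from q^2 = w (y q)^2; hence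
   the need for y q -> 0. *)
have Hb' k : \int[rho]_x (x ^+ 4 * damp k.+1%:R x) =
    N * (al k * (b k + (N - 1) * a k) + be k ^+ 2
         - (N - 1) * (k.+1%:R * q k) ^+ 2) / D k.
  have e1 := Rintegral_sqr_damp_expand (k0 k) i2.
  have e2 := Rintegral_sqr_damp_expand (k0 k) ir2.
  rewrite mu2 -/(a k) -/(b k) -/(w k) in e1.
  rewrite rho2 -/(a' k) -/(w k) in e2.
  apply: (mulfI (lt0r_neq0 (w0 k))).
  have -> : w k * \int[rho]_x (x ^+ 4 * damp k.+1%:R x) = N - a' k.
    by rewrite e2; ring.
  apply: (mulIf (D0 k)); rewrite mulrA divfK// Ha mulrBl divfK//.
  have -> : w k * (N * (al k * (b k + (N - 1) * a k) + be k ^+ 2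
       - (N - 1) * (k.+1%:R * q k) ^+ 2)) =
    N * (al k * (w k * b k + (N - 1) * w k * a k) + w k * be k ^+ 2
       - (N - 1) * q k ^+ 2).
    by rewrite exprMn /w; field.
  have -> : w k * b k = 1 - a k by rewrite e1; ring.
  by rewrite /D /be /al; ring.
have cb' : \int[rho]_x (x ^+ 4 * damp k.+1%:R x) @[k --> \oo] --> N * (m4 + N - 1).
  rewrite [X in _ --> X](_ : _ = N * (1 * (m4 + (N - 1) * 1) + 0 * 0
     - (N - 1) * (0 * 0)) * 1); last by ring.
  under eq_fun do rewrite Hb'.
  apply: cvgM => //; apply: cvgM; first exact: cvg_cst.
  apply: cvgB.
    apply: cvgD.
      apply: cvgM => //; apply: cvgD => //; apply: cvgM => //.
      exact: cvg_cst.
    by under eq_fun do rewrite expr2; exact: cvgM.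
  apply: cvgM; first exact: cvg_cst.
  by under eq_fun do rewrite expr2; exact: cvgM.
have [ir4 rho4] : rho.-integrable setT (EFin \o (fun x => x ^+ 4)) /\
    \int[rho]_x x ^+ 4 = N * (m4 + N - 1).
  apply: Rintegral_damp_lim cb' => //.
  - by move=> x; exact: exprn_even_ge0.
  - by move=> k; exact: integrable_expr4_damp.
by split.
Qed.

(** * Dilation and conclusion *)

Section dilation.
Context {R : realType} (c : R) (mu : probability R R).
Implicit Types f : R -> R.

Lemma Rintegral_dilation f : measurable_fun setT f ->
  mu.-integrable setT (EFin \o (fun x => f (c * x))) ->
  \int[dilation c mu]_x f x = \int[mu]_x f (c * x).
Proof.
by move=> mf fi; rewrite /Rintegral integral_distribution//; exact/measurable_EFinP.
Qed.

Lemma integrable_dilation f : measurable_fun setT f ->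
  mu.-integrable setT (EFin \o (fun x => f (c * x))) ->
  (dilation c mu).-integrable setT (EFin \o f).
Proof.
move=> mf fi; apply: (@integrable_pushforward _ _ _ _ _ (scale_map c)) => //.
exact/measurable_EFinP.
Qed.

End dilation.

Theorem corollary3p5 (R : realType) (mu : probability R R)
    (m1 : moment 1 mu = 0%E) (m2 : moment 2 mu = 1%E)
    (m4 : (moment 4 mu < +oo)%E)
    (n : nat) (hn : (1 <= n)%N)
    (mupow : probability R R)
    (hpow : is_boolean_power mu n mupow) :
  (wasserstein1 (dilation (1 / Num.sqrt (n%:R : R)) mupow) (@rademacher R)
   <= ((1 / Num.sqrt (n%:R : R)) * Num.sqrt (fine (moment 4 mu) - 1))%:E)%E.
Proof.
have n0 : 0 < n%:R :> R by rewrite ltr0n.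
have i4 : mu.-integrable setT (EFin \o (fun x => x ^+ 4)).
  apply/integrableP; split; first exact/measurable_EFinP.
  by under eq_integral => x _ do rewrite /= ger0_norm ?exprn_even_ge0//.
have mu1 : \int[mu]_x x = 0.
  by rewrite /Rintegral -[X in fine X]/(moment 1 mu) m1.
have mu2 : \int[mu]_x x ^+ 2 = 1.
  by rewrite /Rintegral -[X in fine X]/(moment 2 mu) m2.
have HK (z : R[i]) : 0 < complex.Im z ->
    K_transform mupow z = ((n%:R : R)%:C)%C * K_transform mu z.
  by move=> z0; rewrite (boolean_power_K hpow z0) rmorph_nat.
have n1 : 1 <= n%:R :> R by rewrite ler1n.
have [r4 rho1 rho2 rho4] := boolean_power_moments n1 i4 mu1 mu2 HK.
(* [fine] does not meet an infinite value here: x^4 is nonnegative and its integral is finite by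
   [m4]. *)
rewrite -[fine _]/(\int[mu]_x x ^+ 4).
set M := \int[mu]_x x ^+ 4 in rho4 *.
set c := 1 / Num.sqrt (n%:R : R).
have c2 : c ^+ 2 = n%:R^-1 by rewrite /c div1r exprVn sqr_sqrtr// ltW.
have [r1 r2] : mupow.-integrable setT (EFin \o (fun x => x)) /\
    mupow.-integrable setT (EFin \o (fun x => x ^+ 2)).
  have r2 : mupow.-integrable setT (EFin \o (fun x => x ^+ 2)).
    by apply: integrable_of_sqr => //; under eq_fun do rewrite /= -exprM.
  by split => //; exact: integrable_of_sqr.
have nu2 : mupow.-integrable setT (EFin \o (fun x => (c * x) ^+ 2)).
  by under eq_fun do rewrite /= exprMn; exact: integrable_EFinZl.
(* Since c^2 = 1/n, expanding the square gives (M + n - 1)/n - 2 + 1 = (M - 1)/n. *)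
have nuE : mupow.-integrable setT (EFin \o (fun x => ((c * x) ^+ 2 - 1) ^+ 2)) /\
    \int[mupow]_x ((c * x) ^+ 2 - 1) ^+ 2 = n%:R^-1 * (M - 1).
  have e x : ((c * x) ^+ 2 - 1) ^+ 2
      = c ^+ 4 * x ^+ 4 + (1 + - (2 * c ^+ 2) * x ^+ 2) by ring.
  have j4 := integrable_EFinZl (c ^+ 4) r4.
  have j2 := integrable_EFinZl (- (2 * c ^+ 2)) r2.
  have j0 := integrable_EFin_cst mupow 1.
  have j := integrable_EFinD j0 j2.
  split; first by under eq_fun do rewrite /= e; exact: integrable_EFinD.
  under eq_Rintegral do rewrite e.
  rewrite (RintegralD measurableT j4 j) (RintegralD measurableT j0 j2) !RintegralZl// Rintegral_cstT.
  rewrite rho2 rho4 (_ : c ^+ 4 = c ^+ 2 * c ^+ 2); last by ring.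
  by rewrite c2; field; rewrite gt_eqF.
have mc : measurable_fun setT (fun x => (c * x) ^+ 2 - 1).
  by apply: measurable_funB => //; apply: measurable_funX; exact: measurable_funM.
have [nui nuV] := nuE.
apply: (le_trans (wasserstein1_rademacher_le _ _)).
- exact: integrable_dilation.
- rewrite Rintegral_dilation// ?RintegralZl// ?rho1 ?mulr0//.
  exact: integrable_EFinZl.
rewrite lee_fin Rintegral_dilation; last 2 first.
- by apply: measurableT_comp => //; exact: measurable_funB.
- apply: integrable_of_sqr; first exact: measurableT_comp.
  by under eq_fun do rewrite /= real_normK ?num_real//.
rewrite (le_trans (Rintegral_norm_le_sqrt mc nui))// nuV.
by rewrite sqrtrM ?invr_ge0 ?(ltW n0)// sqrtrV ?(ltW n0)// /c div1r.
Qed.
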